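(* Let $\Omega$ be a nc set, $\mathcal A$ a unital $C^*$-algebra, $\mathcal U,\mathcal Y$ Hilbert spaces. Given cp global (respectively cp nc) kernels $K'$ and $K$ from $\Omega\times\Omega$ to $\mathcal L(\mathcal A,\mathcal L(\mathcal U))_{\rm nc}$ and $\mathcal L(\mathcal A,\mathcal L(\mathcal Y))_{\rm nc}$ respectively, and given a global (respectively nc) function $S$ from $\Omega$ to $\mathcal L(\mathcal U,\mathcal Y)_{\rm nc}$, the following are equivalent: (1) $S$ is a contractive multiplier from $\mathcal H(K')$ to $\mathcal H(K)$, i.e. the operator $M_S\colon f\mapsto M_Sf$, $(M_Sf)(W)=S(W)f(W)$, maps $\mathcal H(K')$ boundedly into $\mathcal H(K)$ with operator norm at most $1$. (2) The kernel $K_S$ from $\Omega\times\Omega$ to $\mathcal L(\mathcal A,\mathcal L(\mathcal Y))_{\rm nc}$ given by $$K_S(Z,W)(P)=K(Z,W)(P)-S(Z)\,K'(Z,W)(P)\,S(W)^*$$ is a cp global (respectively cp nc) kernel.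
   Context: For a set $\mathcal S$, $\mathcal S_{\rm nc}=\coprod_{n\ge1}\mathcal S^{n\times n}$; $\Omega\subset\mathcal S_{\rm nc}$ is a nc set if closed under direct sums $(Z,W)\mapsto\begin{bmatrix}Z&0\\0&W\end{bmatrix}$; $\Omega_n=\Omega\cap\mathcal S^{n\times n}$. In the nc case $\mathcal S=\mathcal V$ is a complex vector space. $\mathcal L(\mathcal X,\mathcal Y)$ denotes bounded linear operators, $\mathcal L(\mathcal X,\mathcal Y)^{n\times n}\cong\mathcal L(\mathcal X^n,\mathcal Y^n)$. A function $f\colon\Omega\to\mathcal L(\mathcal X,\mathcal Y)_{\rm nc}$ is a global function if it is graded ($f(Z)\in\mathcal L(\mathcal X,\mathcal Y)^{n\times n}$ for $Z\in\Omega_n$) and $f\left(\begin{bmatrix}Z&0\\0&W\end{bmatrix}\right)=\begin{bmatrix}f(Z)&0\\0&f(W)\end{bmatrix}$; a nc function if it is graded and $\alpha Z=\widetilde Z\alpha$ ($Z\in\Omega_n$, $\widetilde Z\in\Omega_m$, $\alpha\in\mathbb C^{m\times n}$) implies $\alpha f(Z)=f(\widetilde Z)\alpha$. A function $K\colon\Omega\times\Omega\to\mathcal L(\mathcal A,\mathcal L(\mathcal Y))_{\rm nc}$ is graded if for $Z\in\Omega_n$, $W\in\Omega_m$, $K(Z,W)$ is a linear map $\mathcal A^{n\times m}\to\mathcal L(\mathcal Y)^{n\times m}\cong\mathcal L(\mathcal Y^m,\mathcal Y^n)$. It is a global kernel if graded and $$K\left(\begin{bmatrix}Z&0\\ 0&\widetilde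 Z\end{bmatrix},\begin{bmatrix}W&0\\ 0&\widetilde W\end{bmatrix}\right)\left(\begin{bmatrix}P_{11}&P_{12}\\ P_{21}&P_{22}\end{bmatrix}\right)=\begin{bmatrix}K(Z,W)(P_{11})&K(Z,\widetilde W)(P_{12})\\ K(\widetilde Z,W)(P_{21})&K(\widetilde Z,\widetilde W)(P_{22})\end{bmatrix};$$ a nc kernel if graded and $\alpha Z=\widetilde Z\alpha$, $\beta W=\widetilde W\beta$ ($\alpha\in\mathbb C^{\tilde n\times n}$, $\beta\in\mathbb C^{\tilde m\times m}$), $P\in\mathcal A^{n\times m}$ imply $\alpha K(Z,W)(P)\beta^*=K(\widetilde Z,\widetilde W)(\alpha P\beta^* )$. A global/nc kernel is cp if $K(Z,Z)(P)\succeq0$ whenever $Z\in\Omega_n$, $P\succeq0$ in $\mathcal A^{n\times n}$, $n\in\mathbb N$. $\mathcal A^n$ denotes columns, $\mathcal A^{1\times m}$ rows over $\mathcal A$; $v^*$ is conjugate transpose. For a cp global (nc) kernel $K$, $\mathcal H(K)$ is the unique Hilbert space of global (nc) functions $f\colon\Omega\to\mathcal L(\mathcal A,\mathcal Y)_{\rm nc}$ such that: (a) for $W\in\Omega_m$, $v\in\mathcal A^{1\times m}$, $y\in\mathcal Y^m$ the function $K_{W,v,y}(Z)u=K(Z,W)(uv)y$ ($Z\in\Omega_n$, $u\in\mathcal A^n$) belongs to $\mathcal H(K)$; (b) $\langle f(W)(v^* ),y\rangle_{\mathcal Y^m}=\langle f,K_{W,v,y}\rangle_{\mathcal H(K)}$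 for all $f\in\mathcal H(K)$; (c) $(\sigma(a)f)(W)(v^* )=f(W)(v^*a)$ defines a unital $*$-representation $\sigma$ of $\mathcal A$ on $\mathcal H(K)$. *)

(* Defs.v *)
From HB Require Import structures.
From mathcomp Require Import all_boot all_order all_algebra.
From mathcomp Require Import complex.
From mathcomp Require Import all_classical all_reals all_analysis.

Set Implicit Arguments.
Unset Strict Implicit.
Unset Printing Implicit Defensive.
Import Order.TTheory GRing.Theory Num.Theory.
Import numFieldNormedType.Exports.
Local Open Scope classical_set_scope.
Local Open Scope complex_scope.
Local Open Scope ring_scope.

(* Complex Hilbert spaces; the inner product is linear on the left. *)
HB.mixin Record isHilbert (R : realType) (H : Type)
    of CompleteNormedModule R[i] H := {
  dot : H -> H -> R[i] ;
  dot_linearl : forall (c : R[i]) (x y z : H),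
    dot (c *: x + y) z = c * dot x z + dot y z ;
  dot_conj : forall x y : H, dot y x = (dot x y)^* ;
  dot_norm : forall x : H, dot x x = `|x| ^+ 2
}.

#[short(type="hilbertType")]
HB.structure Definition Hilbert (R : realType) :=
  { H of CompleteNormedModule R[i] H & isHilbert R H }.

(* Unital C*-algebras.  The multiplication is a field of the mixin because
   Hierarchy Builder cannot join ring and normed module structures on the same
   type below numDomainType; the instance of pzRingType is declared on top of
   it.  The zero algebra is included. *)
HB.mixin Record isCStar (R : realType) (A : Type)
    of CompleteNormedModule R[i] A := {
  cstar_one : A ;
  cstar_mul : A -> A -> A ;
  star : A -> A ;
  cstar_mulA : associative cstar_mul ;
  cstar_mul1l : left_id cstar_one cstar_mul ;
  cstar_mul1r : right_id cstar_one cstar_mul ;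
  cstar_mulDl : left_distributive cstar_mul +%R ;
  cstar_mulDr : right_distributive cstar_mul +%R ;
  cstar_scaleAl : forall (c : R[i]) (a b : A),
    c *: cstar_mul a b = cstar_mul (c *: a) b ;
  cstar_scaleAr : forall (c : R[i]) (a b : A),
    c *: cstar_mul a b = cstar_mul a (c *: b) ;
  cstar_normM : forall a b : A, `|cstar_mul a b| <= `|a| * `|b| ;
  star_semilinear : forall (c : R[i]) (a b : A),
    star (c *: a + b) = c^* *: star a + star b ;
  starM : forall a b : A, star (cstar_mul a b) = cstar_mul (star b) (star a) ;
  starK : forall a : A, star (star a) = a ;
  cstar_identity : forall a : A, `|cstar_mul (star a) a| = `|a| ^+ 2
}.

#[short(type="cstarType")]
HB.structure Definition CStar (R : realType) :=
  { A of CompleteNormedModule R[i] A & isCStar R A }.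

HB.instance Definition _ (R : realType) (A : cstarType R) :=
  GRing.Zmodule_isPzRing.Build (CStar.sort A)
    cstar_mulA cstar_mul1l cstar_mul1r cstar_mulDl cstar_mulDr.

Section BoundedOperators.
Variables (K : numFieldType) (X Y : normedModType K).

Definition bounded_linear (f : X -> Y) : Prop :=
  linear f /\ exists M : K, forall x : X, `|f x| <= M * `|x|.

Definition bounded_linear_pred : {pred X -> Y} := fun f => `[< bounded_linear f >].

Record bop := Bop { bop_fun :> X -> Y ; bopP : bop_fun \in bounded_linear_pred }.

HB.instance Definition _ := [isSub for bop_fun].
HB.instance Definition _ := [Choice of bop by <:].

Fact bounded_linear_submod : submod_closed bounded_linear_pred.
Proof.
split=> [|c f g].
  apply/asboolP; split=> [a x y|]; first by rewrite scaler0 addr0.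
  by exists 0 => x; rewrite mul0r normr0.
move=> /asboolP[lf [M1 bf]] /asboolP[lg [M2 bg]].
apply/asboolP; split=> [a x y|].
  by rewrite !fctE lf lg !scalerDr !scalerA (mulrC c a) addrACA.
exists (`|c| * M1 + M2) => x; rewrite !fctE mulrDl.
apply: le_trans (ler_normD _ _) _; apply: lerD => //.
by rewrite normrZ -mulrA ler_wpM2l.
Qed.

HB.instance Definition _ :=
  GRing.isSubmodClosed.Build K (X -> Y) bounded_linear_pred
    bounded_linear_submod.
HB.instance Definition _ := [SubChoice_isSubLmodule of bop by <:].

End BoundedOperators.

Notation "''L' ( X , Y )" := (bop X Y) (at level 8, format "''L' ( X ,  Y )").

Section Composition.
Variables (K : numFieldType) (X Y Z : normedModType K).

Fact bop_comp_subproof (T : 'L(Y, Z)) (T' : 'L(X, Y)) :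
  (fun x => T (T' x)) \in @bounded_linear_pred K X Z.
Proof.
case: T T' => f /asboolP[lf [M bf]] [g /asboolP[lg [N bg]]] /=.
apply/asboolP; split=> [a x y|]; first by rewrite lg lf.
exists (`|M| * N) => x; rewrite -mulrA; apply: le_trans (bf _) _.
have [g0|gn0] := eqVneq `|g x| 0.
  rewrite g0 mulr0; apply: mulr_ge0 => //.
  by apply: le_trans (bg x); rewrite g0.
apply: le_trans (ler_wpM2l (normr_ge0 M) (bg x)).
have g_gt0 : 0 < `|g x| by rewrite lt0r gn0 normr_ge0.
have : 0 <= M * `|g x| by apply: le_trans (bf _).
by rewrite pmulr_lge0 // => M0; rewrite ger0_norm.
Qed.

Definition bop_comp (T : 'L(Y, Z)) (T' : 'L(X, Y)) : 'L(X, Z) :=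
  Bop (bop_comp_subproof T T').

End Composition.

(* The Hilbert space adjoint; it exists and is unique by the Riesz
   representation theorem, so the default value 0 is never used. *)
Definition adjoint (R : realType) (X Y : hilbertType R) (T : 'L(X, Y)) :
    'L(Y, X) :=
  xget 0 [set T' : 'L(Y, X) | forall x y, dot (T x) y = dot x (T' y)].

Section OperatorMatrices.
Variables (K : numFieldType) (X Y Z : normedModType K).

Definition opmx_mul n p m (S : 'M['L(Y, Z)]_(n, p)) (T : 'M['L(X, Y)]_(p, m)) :
    'M['L(X, Z)]_(n, m) :=
  \matrix_(i, j) \sum_k bop_comp (S i k) (T k j).

(* L(X, Y)^{n x m} acting as L(X^m, Y^n). *)
Definition opmx_app n m (T : 'M['L(X, Y)]_(n, m)) (u : 'cV[X]_m) : 'cV[Y]_n :=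
  \col_i \sum_j T i j (u j 0).

End OperatorMatrices.

Definition opmx_adj (R : realType) (X Y : hilbertType R) n m
    (T : 'M['L(X, Y)]_(n, m)) : 'M['L(Y, X)]_(m, n) :=
  \matrix_(i, j) adjoint (T j i).

Definition cvdot (R : realType) (Y : hilbertType R) n (y z : 'cV[Y]_n) : R[i] :=
  \sum_i dot (y i 0) (z i 0).

(* The order of R[i] makes 0 <= c mean that c is real and nonnegative. *)
Definition op_psd (R : realType) (Y : hilbertType R) n
    (T : 'M['L(Y, Y)]_n) : Prop :=
  forall y : 'cV[Y]_n, 0 <= cvdot (opmx_app T y) y.

Definition starmx (R : realType) (A : cstarType R) n m (P : 'M[A]_(n, m)) :
    'M[A]_(m, n) := \matrix_(i, j) star (P j i).

(* The positive elements of the C*-algebra A^{n x n} are the Q^* Q. *)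
Definition cstar_psd (R : realType) (A : cstarType R) n (P : 'M[A]_n) : Prop :=
  exists Q : 'M[A]_n, P = starmx Q *m Q.

Section ScalarMatrices.
Variables (K : pzRingType) (V : lmodType K).

(* The library scales a matrix only by elements of its own coefficient ring. *)
Definition cscalemx m n (c : K) (Z : 'M[V]_(m, n)) : 'M[V]_(m, n) :=
  map_mx (fun z => c *: z) Z.

(* alpha Z and Z beta, for scalar matrices alpha, beta and Z over V; the
   second one is meant for commutative K only. *)
Definition lscalemx m n p (alpha : 'M[K]_(m, n)) (Z : 'M[V]_(n, p)) :
    'M[V]_(m, p) := \matrix_(i, j) \sum_k alpha i k *: Z k j.

Definition rscalemx m n p (Z : 'M[V]_(m, n)) (beta : 'M[K]_(n, p)) :
    'M[V]_(m, p) := \matrix_(i, j) \sum_k beta k j *: Z i k.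

End ScalarMatrices.

Definition adjmx (R : realType) m n (beta : 'M[R[i]]_(m, n)) : 'M[R[i]]_(n, m) :=
  \matrix_(i, j) (beta j i)^*.

(* A subset of the disjoint union of the T^{n x n}, n >= 1, is given by its
   graded components; nc_set makes the n = 0 component empty. *)
Definition ncsubset (T : Type) := forall n, set 'M[T]_n.

(* A function on Omega is represented by a graded family of total functions,
   whose values off Omega are irrelevant and never referred to. *)
Definition ncfun (T B : Type) := forall n, 'M[T]_n -> 'M[B]_n.

Definition nckernel (R : realType) (A : cstarType R) (Y : hilbertType R)
    (T : Type) :=
  forall n m, 'M[T]_n -> 'M[T]_m -> 'M[A]_(n, m) -> 'M['L(Y, Y)]_(n, m).

(* o is the element of T used as the off-diagonal entry of direct sums: the
   zero vector when T is a vector space, a distinguished point otherwise. *)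
Definition dsum (T : Type) (o : T) n m (Z : 'M[T]_n) (W : 'M[T]_m) :
    'M[T]_(n + m) := block_mx Z (const_mx o) (const_mx o) W.

Definition nc_set (T : Type) (o : T) (Omega : ncsubset T) : Prop :=
  Omega 0%N = set0 /\
  forall n m (Z : 'M[T]_n) (W : 'M[T]_m),
    Omega n Z -> Omega m W -> Omega (n + m)%N (dsum o Z W).

Definition global_function (T : Type) (o : T) (Omega : ncsubset T)
    (B : nmodType) (f : ncfun T B) : Prop :=
  forall n m (Z : 'M[T]_n) (W : 'M[T]_m), Omega n Z -> Omega m W ->
    f (n + m)%N (dsum o Z W) = block_mx (f n Z) 0 0 (f m W).

Definition nc_function (K : pzRingType) (V : lmodType K) (Omega : ncsubset V)
    (B : lmodType K) (f : ncfun V B) : Prop :=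
  forall n m (Z : 'M[V]_n) (Zt : 'M[V]_m) (alpha : 'M[K]_(m, n)),
    Omega n Z -> Omega m Zt ->
    lscalemx alpha Z = rscalemx Zt alpha ->
    lscalemx alpha (f n Z) = rscalemx (f m Zt) alpha.

Section Kernels.
Variables (R : realType) (A : cstarType R) (Y : hilbertType R).

(* Linearity only: boundedness in the variable of A^{n x m} is automatic for cp
   kernels. *)
Definition graded_kernel (T : Type) (Omega : ncsubset T)
    (K : nckernel A Y T) : Prop :=
  forall n m (Z : 'M[T]_n) (W : 'M[T]_m), Omega n Z -> Omega m W ->
  forall (c : R[i]) (P Q : 'M[A]_(n, m)),
    K n m Z W (cscalemx c P + Q) = cscalemx c (K n m Z W P) + K n m Z W Q.

Definition global_kernel (T : Type) (o : T) (Omega : ncsubset T)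
    (K : nckernel A Y T) : Prop :=
  graded_kernel Omega K /\
  forall n nt m mt (Z : 'M[T]_n) (Zt : 'M[T]_nt) (W : 'M[T]_m) (Wt : 'M[T]_mt)
    (P11 : 'M[A]_(n, m)) (P12 : 'M[A]_(n, mt))
    (P21 : 'M[A]_(nt, m)) (P22 : 'M[A]_(nt, mt)),
    Omega n Z -> Omega nt Zt -> Omega m W -> Omega mt Wt ->
    K (n + nt)%N (m + mt)%N (dsum o Z Zt) (dsum o W Wt)
      (block_mx P11 P12 P21 P22) =
    block_mx (K n m Z W P11) (K n mt Z Wt P12)
             (K nt m Zt W P21) (K nt mt Zt Wt P22).

Definition nc_kernel (V : lmodType R[i]) (Omega : ncsubset V)
    (K : nckernel A Y V) : Prop :=
  graded_kernel Omega K /\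
  forall n nt m mt (Z : 'M[V]_n) (Zt : 'M[V]_nt) (W : 'M[V]_m) (Wt : 'M[V]_mt)
    (alpha : 'M[R[i]]_(nt, n)) (beta : 'M[R[i]]_(mt, m)) (P : 'M[A]_(n, m)),
    Omega n Z -> Omega nt Zt -> Omega m W -> Omega mt Wt ->
    lscalemx alpha Z = rscalemx Zt alpha ->
    lscalemx beta W = rscalemx Wt beta ->
    rscalemx (lscalemx alpha (K n m Z W P)) (adjmx beta) =
    K nt mt Zt Wt (rscalemx (lscalemx alpha P) (adjmx beta)).

Definition cp (T : Type) (Omega : ncsubset T) (K : nckernel A Y T) : Prop :=
  forall n (Z : 'M[T]_n), Omega n Z ->
  forall P : 'M[A]_n, cstar_psd P -> op_psd (K n n Z Z P).

Definition cp_global_kernel (T : Type) (o : T) (Omega : ncsubset T)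
    (K : nckernel A Y T) : Prop :=
  global_kernel o Omega K /\ cp Omega K.

Definition cp_nc_kernel (V : lmodType R[i]) (Omega : ncsubset V)
    (K : nckernel A Y V) : Prop :=
  nc_kernel Omega K /\ cp Omega K.

(* f = K_{W,v,y} on Omega. *)
Definition is_kernel_function (T : Type) (Omega : ncsubset T)
    (K : nckernel A Y T) m (W : 'M[T]_m) (v : 'rV[A]_m) (y : 'cV[Y]_m)
    (f : ncfun T 'L(A, Y)) : Prop :=
  forall n (Z : 'M[T]_n), Omega n Z -> forall u : 'cV[A]_n,
    opmx_app (f n Z) u = opmx_app (K n m Z W (u *m v)) y.

Definition unital_star_rep (H : hilbertType R) (sigma : A -> 'L(H, H)) : Prop :=
  [/\ forall (c : R[i]) (a b : A) (f : H),
        sigma (c *: a + b) f = c *: sigma a f + sigma b f,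
      forall (a b : A) (f : H), sigma (a * b) f = sigma a (sigma b f),
      forall f : H, sigma 1 f = f &
      forall (a : A) (f g : H), dot (sigma a f) g = dot f (sigma (star a) g)].

(* H, with its elements read as functions on Omega through the linear and
   injective map ev, is H(K); class is the class of functions (global or nc)
   in which H(K) is required to lie.  H(K) being unique, a statement about
   H(K) is one about all H and ev with this property. *)
Record is_rkhs (T : Type) (Omega : ncsubset T)
    (class : ncfun T 'L(A, Y) -> Prop) (K : nckernel A Y T)
    (H : hilbertType R) (ev : H -> ncfun T 'L(A, Y)) : Prop := IsRKHS {
  rkhs_linear : forall (c : R[i]) (f g : H) n (Z : 'M[T]_n), Omega n Z ->
    ev (c *: f + g) n Z = cscalemx c (ev f n Z) + ev g n Z ;
  rkhs_inj : forall f g : H,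
    (forall n (Z : 'M[T]_n), Omega n Z -> ev f n Z = ev g n Z) -> f = g ;
  rkhs_class : forall f : H, class (ev f) ;
  rkhs_kernel : forall m (W : 'M[T]_m) (v : 'rV[A]_m) (y : 'cV[Y]_m),
    Omega m W -> exists k : H, is_kernel_function Omega K W v y (ev k) ;
  rkhs_reproducing : forall m (W : 'M[T]_m) (v : 'rV[A]_m) (y : 'cV[Y]_m) (k : H),
    Omega m W -> is_kernel_function Omega K W v y (ev k) ->
    forall f : H, cvdot (opmx_app (ev f m W) (starmx v)) y = dot f k ;
  rkhs_rep : exists sigma : A -> 'L(H, H), unital_star_rep sigma /\
    forall (a : A) (f : H) m (W : 'M[T]_m) (v : 'rV[A]_m), Omega m W ->
      opmx_app (ev (sigma a f) m W) (starmx v) =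
      opmx_app (ev f m W) (map_mx (fun b => b * a) (starmx v))
}.

End Kernels.

Definition contractive_multiplier (R : realType) (A : cstarType R)
    (U Y : hilbertType R) (T : Type) (Omega : ncsubset T)
    (S : ncfun T 'L(U, Y))
    (H' : hilbertType R) (ev' : H' -> ncfun T 'L(A, U))
    (H : hilbertType R) (ev : H -> ncfun T 'L(A, Y)) : Prop :=
  exists M : 'L(H', H),
    (forall (f : H') n (W : 'M[T]_n), Omega n W ->
       ev (M f) n W = opmx_mul (S n W) (ev' f n W)) /\
    (forall f : H', `|M f| <= (`|f| : R[i])).

Definition kernel_S (R : realType) (A : cstarType R) (U Y : hilbertType R)
    (T : Type) (K' : nckernel A U T) (K : nckernel A Y T)
    (S : ncfun T 'L(U, Y)) : nckernel A Y T :=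
  fun n m Z W P =>
    K n m Z W P -
    opmx_mul (opmx_mul (S n Z) (K' n m Z W P)) (opmx_adj (S m W)).

(* Main.v *)
(* With k = K_{W,v,y} and k' = K'_{W,v,S(W)^* y}, the reproducing property gives
     <K_S(W,W)(v^* v) y, y> = |k|^2 - |k'|^2   and   <M_S f, k> = <f, k'>.
   If M_S is a contraction, then |k'|^2 = <M_S k', k> <= |k'| |k|, so the left
   hand side is nonnegative; a general positive matrix Q^* Q is the sum of the
   v^* v over the rows v of Q.  Conversely, if K_S is cp, then |k'| <= |k|.
   Kernel functions at W1 and W2 add up to a kernel function at the direct sum
   of W1 and W2, so k |-> k' is a well defined linear contraction on the subspace
   of all kernel functions, and S f is the Riesz representer of k |-> <k', f>. *)
Require Import Defs.
From mathcomp Require Import all_boot all_order all_algebra.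
From mathcomp Require Import complex ring lra.
From mathcomp Require Import all_classical all_reals all_analysis.

Set Implicit Arguments.
Unset Strict Implicit.
Unset Printing Implicit Defensive.
Import Order.TTheory GRing.Theory Num.Theory.
Import numFieldNormedType.Exports.
Local Open Scope classical_set_scope.
Local Open Scope complex_scope.
Local Open Scope ring_scope.

(** * Real part of the inner product, Cauchy-Schwarz and completeness *)

Section InnerProduct.
Variables (R : realType) (H : hilbertType R).
Implicit Types (x y z : H) (c : R[i]).

Lemma dotDl x y z : dot (x + y) z = dot x z + dot y z.
Proof. by rewrite -[x]scale1r dot_linearl mul1r scale1r. Qed.

Lemma dot0l z : dot 0 z = 0.
Proof. by apply: (@addIr _ (dot 0 z)); rewrite -dotDl !add0r. Qed.

Lemma dotZl c x z : dot (c *: x) z = c * dot x z.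
Proof. by rewrite -[c *: x]addr0 dot_linearl dot0l addr0. Qed.

Lemma dotNl x z : dot (- x) z = - dot x z.
Proof. by rewrite -scaleN1r dotZl mulN1r. Qed.

Lemma dotBl x y z : dot (x - y) z = dot x z - dot y z.
Proof. by rewrite dotDl dotNl. Qed.

Lemma dotDr x y z : dot z (x + y) = dot z x + dot z y.
Proof. by rewrite dot_conj dotDl [dot z x]dot_conj [dot z y]dot_conj -rmorphD. Qed.

Lemma dot0r z : dot z 0 = 0.
Proof. by rewrite dot_conj dot0l rmorph0. Qed.

Lemma dotZr c x z : dot z (c *: x) = c^* * dot z x.
Proof. by rewrite dot_conj dotZl [dot z x]dot_conj -rmorphM. Qed.

Lemma dot_suml (I : Type) (r : seq I) (P : pred I) (F : I -> H) z :
  dot (\sum_(i <- r | P i) F i) z = \sum_(i <- r | P i) dot (F i) z.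
Proof.
by apply: (big_morph (fun x => dot x z)) => [x y|]; rewrite ?dotDl ?dot0l.
Qed.

Lemma dot_sumr (I : Type) (r : seq I) (P : pred I) (F : I -> H) z :
  dot z (\sum_(i <- r | P i) F i) = \sum_(i <- r | P i) dot z (F i).
Proof.
by apply: (big_morph (fun x => dot z x)) => [x y|]; rewrite ?dotDr ?dot0r.
Qed.

Lemma dot_ext x y : (forall z, dot x z = dot y z) -> x = y.
Proof.
move=> xy; apply/eqP; rewrite -subr_eq0 -normr_eq0 -sqrf_eq0 -dot_norm dotBl.
by rewrite xy subrr.
Qed.

(** Norms take values in [R[i]], whose order is only partial; real parts move all estimates to the
    ordered field [R]. *)
Definition rdot x y : R := complex.Re (dot x y).
Definition rnorm x : R := complex.Re `|x|.

Lemma rnormE x : `|x| = (rnorm x)%:C.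
Proof. by rewrite /rnorm RRe_real // ger0_real. Qed.

Lemma rnorm_ge0 x : 0 <= rnorm x.
Proof. by rewrite -ler0c -rnormE. Qed.

Lemma rdot_norm x : rdot x x = rnorm x ^+ 2.
Proof. by rewrite /rdot dot_norm rnormE -rmorphXn. Qed.

Lemma rdotDl x y z : rdot (x + y) z = rdot x z + rdot y z.
Proof. by rewrite /rdot dotDl raddfD. Qed.

Lemma rdotC x y : rdot x y = rdot y x.
Proof. by rewrite /rdot dot_conj; case: (dot y x). Qed.

Lemma rdotZl (t : R) x y : rdot (t%:C *: x) y = t * rdot x y.
Proof. by rewrite /rdot dotZl; case: (dot x y) => a b /=; rewrite mul0r subr0. Qed.

Lemma rdotNl x y : rdot (- x) y = - rdot x y.
Proof. by rewrite /rdot dotNl raddfN. Qed.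

Lemma rdotDr x y z : rdot z (x + y) = rdot z x + rdot z y.
Proof. by rewrite rdotC rdotDl -!(rdotC z). Qed.

Lemma rdotZr (t : R) x y : rdot y (t%:C *: x) = t * rdot y x.
Proof. by rewrite rdotC rdotZl rdotC. Qed.

Lemma rdotNr x y : rdot y (- x) = - rdot y x.
Proof. by rewrite rdotC rdotNl rdotC. Qed.

Definition rdotE := (rdotDl, rdotDr, rdotNl, rdotNr, rdotZl, rdotZr).

(** Cauchy-Schwarz: expand [|z|^2 >= 0] for [z = |y|^2 x - Re <x, y> y] and cancel the factor
    [|y|^2]. *)
Lemma rdot_le x y : rdot x y <= rnorm x * rnorm y.
Proof.
have [y0|y0] := eqVneq (rnorm y) 0.
  have -> : y = 0 by apply/eqP; rewrite -normr_eq0 rnormE y0.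
  by rewrite /rdot dot0r mulr_ge0 ?rnorm_ge0.
have yp : 0 < rnorm y by rewrite lt0r y0 rnorm_ge0.
apply: le_trans (ler_norm _) _.
rewrite -ler_sqr ?nnegrE ?mulr_ge0 ?rnorm_ge0 // real_normK ?num_real // exprMn.
set z := (rnorm y ^+ 2)%:C *: x - (rdot x y)%:C *: y.
have zE : rdot z z =
    rnorm y ^+ 2 * (rnorm x ^+ 2 * rnorm y ^+ 2 - rdot x y ^+ 2).
  by rewrite /z !rdotE (rdotC y x) !rdot_norm; ring.
have : 0 <= rdot z z by rewrite rdot_norm sqr_ge0.
by rewrite zE pmulr_rge0 ?exprn_gt0 // subr_ge0.
Qed.

Lemma rnormD x y : rnorm (x + y) <= rnorm x + rnorm y.
Proof. by rewrite -lecR -rnormE (le_trans (ler_normD _ _)) // !rnormE -rmorphD. Qed.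

Lemma rnormN x : rnorm (- x) = rnorm x.
Proof. by rewrite /rnorm normrN. Qed.

(** Completeness in the form suited to minimising sequences: the hypothesis makes the sequence
    Cauchy, and the conclusion offers one index at which both the gap [1/(n+1)] and the distance to
    the limit are small. *)
Lemma rnorm_cauchy_cvg (x : nat -> H) (B : R) :
  (forall n m, rnorm (x n - x m) ^+ 2 <= B * (n.+1%:R^-1 + m.+1%:R^-1)) ->
  exists g, forall e : R, 0 < e ->
    exists2 n, n.+1%:R^-1 < e & rnorm (g - x n) < e.
Proof.
move=> xB.
have small (e : R) : 0 < e -> exists N : nat, forall n, (N <= n)%N -> n.+1%:R^-1 < e.
  move=> e0; have [N _ hN] := near_infty_natSinv_lt (PosNum e0).
  by exists N.
have /cauchy_cvgP/cvg_ex[g xg] : cauchy (x @ \oo).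
  apply/cauchy_exP => e e0.
  have eE : e = (complex.Re e)%:C by rewrite RRe_real // gtr0_real.
  have e1 : 0 < complex.Re e by rewrite -ltcR -eE.
  have B0 : 0 < `|B| + 1 by apply: ltr_wpDl.
  (* Two reciprocals below this threshold add up to less than [e^2 / (|B| + 1)]; the denominator is
     positive whatever the sign of [B]. *)
  have d0 : 0 < complex.Re e ^+ 2 / (2 * (`|B| + 1)).
    by rewrite divr_gt0 ?exprn_gt0 ?mulr_gt0.
  have [N hN] := small _ d0.
  exists (x N); exists N => //= n Nn; rewrite -ball_normE /ball_ /= eE rnormE ltcR.
  rewrite -ltr_sqr ?nnegrE ?rnorm_ge0 ?ltW //.
  apply: le_lt_trans (xB _ _) _.
  set a := N.+1%:R^-1; set b := n.+1%:R^-1.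
  have a0 : 0 < a by rewrite invr_gt0.
  have b0 : 0 < b by rewrite invr_gt0.
  apply: (@lt_le_trans _ _ ((`|B| + 1) * (a + b))).
    by rewrite ltr_pM2r ?addr_gt0 // (le_lt_trans (ler_norm B)) // ltrDl.
  have := hN _ (leqnn N); have := hN _ Nn; rewrite -/a -/b.
  rewrite !ltr_pdivlMr ?mulr_gt0 // => h1 h2.
  by nra.
exists g => e e0.
have [N hN] := small _ e0.
have eC : 0 < e%:C by rewrite ltcR.
have /cvgrPdist_lt/(_ _ eC)[M _ hM] := xg.
exists (maxn N M); first by apply: hN; rewrite leq_maxl.
by have := hM _ (leq_maxr N M); rewrite /= rnormE ltcR.
Qed.

End InnerProduct.

(** * Bounded operators and the Riesz representation theorem *)

Lemma bounded_linearP (K : numFieldType) (X Z : normedModType K) (T : 'L(X, Z)) :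
  bounded_linear T.
Proof. by case: T => f /= /asboolP. Qed.

Lemma bopD (K : numFieldType) (X Z : normedModType K) (T : 'L(X, Z)) x y :
  T (x + y) = T x + T y.
Proof. by have [lT _] := bounded_linearP T; rewrite -[x]scale1r lT !scale1r. Qed.

Lemma bop0 (K : numFieldType) (X Z : normedModType K) (T : 'L(X, Z)) : T 0 = 0.
Proof. by apply: (@addIr _ (T 0)); rewrite -bopD !add0r. Qed.

Lemma bopZ (K : numFieldType) (X Z : normedModType K) (T : 'L(X, Z)) c x :
  T (c *: x) = c *: T x.
Proof.
by have [lT _] := bounded_linearP T; rewrite -[c *: x]addr0 lT bop0 addr0.
Qed.

Lemma bop_sum (K : numFieldType) (X Z : normedModType K) (T : 'L(X, Z))
    (I : Type) (r : seq I) (P : pred I) (F : I -> X) :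
  T (\sum_(i <- r | P i) F i) = \sum_(i <- r | P i) T (F i).
Proof. by apply: (big_morph T) => [x y|]; rewrite ?bopD ?bop0. Qed.

Lemma bop_ext (K : numFieldType) (X Z : normedModType K) (T T' : 'L(X, Z)) :
  (forall x, T x = T' x) -> T = T'.
Proof. by move=> TT'; apply: val_inj; apply/funext. Qed.

(** The constant in [bounded_linear] is an arbitrary element of [R[i]]; its modulus is a real bound
    that serves as well. *)
Lemma bop_rnorm (R : realType) (X Z : hilbertType R) (T : 'L(X, Z)) :
  exists2 M : R, 0 <= M & forall x, rnorm (T x) <= M * rnorm x.
Proof.
have [_ [M bT]] := bounded_linearP T.
have Mr : `|M| = (complex.Re `|M|)%:C by rewrite RRe_real // ger0_real.
exists (complex.Re `|M|); first by rewrite -ler0c -Mr.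
move=> x; rewrite -lecR -rnormE rmorphM /= -rnormE -Mr.
rewrite -[X in _ * X]normr_id -normrM.
by apply: le_trans (bT x) (real_ler_norm _); rewrite ger0_real // (le_trans _ (bT x)).
Qed.

(* The representing vector minimises [|x|^2 - 2 Re l] over [D], up to closure:
   by the parallelogram law minimising sequences are Cauchy. *)
Lemma riesz_relation (R : realType) (H : hilbertType R) (D : set (H * R[i]))
    (C : R) :
  D (0, 0) ->
  (forall c x l y m, D (x, l) -> D (y, m) -> D (c *: x + y, c * l + m)) ->
  0 <= C -> (forall x l, D (x, l) -> complex.Re l <= C * rnorm x) ->
  exists2 g : H, rnorm g <= C & forall x l, D (x, l) -> dot x g = l.
Proof.
move=> D0 Dlin C0 DC.
pose J (p : H * R[i]) := rnorm p.1 ^+ 2 - 2 * complex.Re p.2.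
have JC p : D p -> - C ^+ 2 <= J p.
  by case: p => x l /DC /= h; rewrite /J /=; have := sqr_ge0 (rnorm x - C); nra.
have infJ : has_inf (J @` D).
  split; first by exists (J (0, 0)), (0, 0).
  by exists (- C ^+ 2) => _ [p Dp <-]; apply: JC.
set d := inf (J @` D).
have dJ p : D p -> d <= J p by move=> Dp; apply: (ge_inf infJ.2); exists p.
have /choice[s sP] (n : nat) : exists p, D p /\ J p < d + n.+1%:R^-1.
  have n0 : 0 < n.+1%:R^-1 :> R by rewrite invr_gt0.
  by have [_ [p Dp <-] pd] := inf_adherent n0 infJ; exists p.
clearbody d.
have DS (t : R) x l y m : D (x, l) -> D (y, m) ->
    D (x + t%:C *: y, l + t%:C * m).
  by move=> Dx Dy; rewrite addrC [l + _]addrC; apply: Dlin.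
have ReZ (t : R) (l : R[i]) : complex.Re (t%:C * l) = t * complex.Re l.
  by case: l => a b /=; rewrite mul0r subr0.
have ReD (l m : R[i]) : complex.Re (l + m) = complex.Re l + complex.Re m.
  by case: l m => [a b] [].
have ReN (l : R[i]) : complex.Re (- l) = - complex.Re l by case: l.
have DZ (c : R[i]) x l : D (x, l) -> D (c *: x, c * l).
  by move=> Dx; have := Dlin c _ _ _ _ Dx D0; rewrite !addr0.
(* The midpoint of two pairs lies in [D], and the parallelogram law reads [J(x) + J(y) - 2 J((x +
   y)/2) = |x - y|^2 / 2]; hence the constant 2. *)
have [n m|g gs] := @rnorm_cauchy_cvg _ _ (fst \o s) 2.
  have [Dn Jn] := sP n; have [Dm Jm] := sP m; rewrite /=.
  case: (s n) (s m) Dn Jn Dm Jm => x l [y k] Dx Jx Dy Jy /=.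
  have := dJ _ (DZ (2^-1)%:C _ _ (DS 1 _ _ _ _ Dx Dy)).
  move: Jx Jy; rewrite /J /=; rewrite !(ReZ, ReD) -!rdot_norm !rdotE !mul1r.
  by rewrite (rdotC y x); move: (n.+1%:R^-1) (m.+1%:R^-1) => a b; lra.
(* A pair with [J] within [e] of the infimum is nearly stationary in every direction [(z, k)] of
   [D]; [a] is half the derivative of [J] in that direction. *)
have approx z k e : D (z, k) -> 0 < e -> exists x l,
    [/\ D (x, l), rnorm (g - x) < e &
     (rdot x z - complex.Re k) ^+ 2 <= rnorm z ^+ 2 * e].
  move=> Dz e0; have [n ne gn] := gs _ e0; have [Dn Jn] := sP n.
  exists (s n).1, (s n).2; rewrite -surjective_pairing; split => //.
  case: (s n) Dn Jn {gn} => x l Dx Jx /=.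
  set a := rdot x z - complex.Re k.
  have hJ t : d <= J (x, l) + 2 * t * a + t ^+ 2 * rnorm z ^+ 2.
    have := dJ _ (DS t _ _ _ _ Dx Dz).
    rewrite /J /= ReD ReZ -!rdot_norm !rdotE (rdotC z x) /a.
    by move=> h; apply: le_trans h _; rewrite le_eqVlt; apply/orP; left;
      apply/eqP; ring.
  (* For [z = 0] the bound applied to [(0, k)] and [(0, -k)] forces [Re k = 0]. *)
  have [z0|z0] := eqVneq (rnorm z) 0.
    have z00 : z = 0 by apply/eqP; rewrite -normr_eq0 rnormE z0.
    have /DC := DZ (-1) _ _ Dz; have /DC := Dz.
    rewrite mulN1r ReN scaleN1r rnormN z0 /a z00 /rdot dot0r /=; nra.
  have zp : 0 < rnorm z ^+ 2 by rewrite exprn_gt0 // lt0r z0 rnorm_ge0.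
  (* This [t] minimises the quadratic polynomial on the right of [hJ]. *)
  have := hJ (- a / rnorm z ^+ 2).
  have -> : J (x, l) + 2 * (- a / rnorm z ^+ 2) * a +
     (- a / rnorm z ^+ 2) ^+ 2 * rnorm z ^+ 2 = J (x, l) - a ^+ 2 / rnorm z ^+ 2.
    by field.
  move=> h; rewrite mulrC -ler_pdivrMr //.
  by move: h Jx ne; set q := a ^+ 2 / _; move: (J _) (n.+1%:R^-1) => j b; lra.
have gRe z k : D (z, k) -> rdot z g = complex.Re k.
  move=> Dz; apply/eqP; rewrite -subr_eq0 -sqrf_eq0 eq_le sqr_ge0 andbT.
  set b := _ - _; apply/ler_addgt0Pr => e e0; rewrite add0r.
  (* The error [b] is a sum [a + q] with [a^2] and [q^2] both at most [|z|^2 e'], so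
     [b^2 <= 2 (a^2 + q^2) <= M e']. The cap [e' <= 1] gives [|g - x|^2 <= e']. *)
  pose M := 2 * (rnorm z ^+ 2 + rnorm z ^+ 2).
  have M0 : 0 <= M by rewrite mulr_ge0 // addr_ge0 ?sqr_ge0.
  pose e' := Num.min 1 (e / (M + 1)).
  have e'0 : 0 < e' by rewrite lt_min ltr01 divr_gt0 // ltr_wpDl.
  have [x [l [Dx gx xz]]] := approx _ _ _ Dz e'0.
  have e'1 : e' <= 1 by rewrite ge_min lexx.
  have e'e : e' * (M + 1) <= e.
    by rewrite -ler_pdivlMr ?ltr_wpDl // ge_min lexx orbT.
  set a := rdot x z - complex.Re k in xz.
  have bE : b = a + rdot (g - x) z by rewrite !rdotE /a /b (rdotC z g); ring.
  have h2 : rdot (g - x) z ^+ 2 <= rnorm z ^+ 2 * e'.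
    have h := rdot_le (g - x) z; have h' := rdot_le (- (g - x)) z.
    rewrite rnormN rdotNl in h'.
    have g0 := rnorm_ge0 (g - x); have z0 := rnorm_ge0 z.
    apply: (@le_trans _ _ ((rnorm (g - x) * rnorm z) ^+ 2)).
      rewrite -[X in X <= _](real_normK (num_real _)) ler_sqr ?nnegrE ?mulr_ge0 //.
      by rewrite ler_norml; apply/andP; split; lra.
    rewrite exprMn mulrC ler_wpM2l ?sqr_ge0 // expr2.
    by rewrite -[X in _ <= X]mul1r ler_pM // ltW // (lt_le_trans gx).
  rewrite bE.
  set q := rdot (g - x) z in h2 *; have := sqr_ge0 (a - q); move: xz h2 e'e.
  by rewrite /M; move: (rnorm z ^+ 2) => w; nra.
exists g.
  have [g0|g0] := eqVneq (rnorm g) 0; first by rewrite g0.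
  have gp : 0 < rnorm g by rewrite lt0r g0 rnorm_ge0.
  (* For [x] in the domain of [D] near [g], [|g|^2 = <x, g> + <g - x, g>] is at most
     [C |x| + |g - x| |g|], hence at most [C |g| + (C + |g|) |g - x|]; this dictates the tolerance
     below. *)
  rewrite -(ler_pM2l gp); apply/ler_addgt0Pr => e e0.
  have Cg : 0 < C + rnorm g by rewrite ltr_wpDl.
  have e'0 : 0 < e / (C + rnorm g) by rewrite divr_gt0.
  have [x [l [Dx gx _]]] := approx _ _ _ D0 e'0.
  have xC := DC _ _ Dx; have xg := gRe _ _ Dx.
  have := rdot_le (g - x) g; rewrite !rdotE rdot_norm xg.
  have : rnorm x <= rnorm g + rnorm (g - x).
    by rewrite -(rnormN (g - x)) -[X in rnorm X <= _](subKr g) rnormD.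
  move: gx; rewrite ltr_pdivlMr // => gx h1 h2.
  have := ler_wpM2l C0 h1; nra.
(* So far only real parts agree; the pair multiplied by ['i] supplies the imaginary parts. *)
move=> x l Dx; have := gRe _ _ Dx; have := gRe _ _ (DZ 'i _ _ Dx).
rewrite /rdot dotZl; case: (dot x g) l {Dx} => [a b] [a' b'] /=.
by rewrite !mul0r !mul1r !sub0r => /oppr_inj -> ->.
Qed.

(** * Existence and uniqueness of adjoints *)

Section Adjoint.
Variables (R : realType) (X Z : hilbertType R).

(** For fixed [z] the graph of [u |-> <T u, z>] is a linear relation with bound [M |z|], so Riesz
    gives a representer. It is additive and homogeneous in [z] by uniqueness, and bounded since
    [|f z|^2 = <T (f z), z>]. *)
Lemma adjointP (T : 'L(X, Z)) x y : dot (T x) y = dot x (adjoint T y).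
Proof.
apply: (@xgetPex _ 0 [set T' : 'L(Z, X) | forall x y, dot (T x) y = dot x (T' y)]).
have [M M0 bT] := bop_rnorm T.
have /choice[f fP] (z : Z) : exists g : X, forall u, dot (T u) z = dot u g.
  have [|c u l v m|||g _ gP] := @riesz_relation _ X
    [set p | p.2 = dot (T p.1) z] (M * rnorm z).
  - by rewrite /= bop0 dot0l.
  - by rewrite /= => -> ->; rewrite bopD bopZ dotDl dotZl.
  - by rewrite mulr_ge0 ?rnorm_ge0.
  - move=> u l /= ->; apply: le_trans (rdot_le _ _) _.
    by rewrite mulrAC ler_wpM2r ?rnorm_ge0.
  by exists g => u; rewrite (gP u (dot (T u) z)).
have fb : f \in @bounded_linear_pred _ Z X.
  apply/asboolP; split=> [c u v|].
    by apply: dot_ext => w; rewrite dot_conj [RHS]dot_conj; congr (conjc _);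
      rewrite dotDr dotZr -!fP dotDr dotZr.
  exists M%:C => z; rewrite !rnormE -rmorphM lecR.
  have [->|f0] := eqVneq (rnorm (f z)) 0; first by rewrite mulr_ge0 ?rnorm_ge0.
  have fp : 0 < rnorm (f z) by rewrite lt0r f0 rnorm_ge0.
  rewrite -(ler_pM2l fp) -expr2 -rdot_norm /rdot -fP.
  apply: le_trans (rdot_le _ _) _.
  by rewrite mulrA ler_wpM2r ?rnorm_ge0 // mulrC.
by exists (Bop fb).
Qed.

(** Adjoints are selected by choice, so identities between them, even the one for zero, are obtained
    from the defining relation. *)
Lemma adjoint_unique (T : 'L(X, Z)) (T' : 'L(Z, X)) :
  (forall x y, dot (T x) y = dot x (T' y)) -> adjoint T = T'.
Proof.
move=> TT'; apply: bop_ext => y; apply: dot_ext => x.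
by rewrite dot_conj [RHS]dot_conj -adjointP TT'.
Qed.

End Adjoint.

(** * Algebra of operators and operator matrices *)

Section BoundedOperatorAlgebra.
Variables (K : numFieldType) (X Y : normedModType K).
Implicit Types T : 'L(X, Y).

Lemma bopZE c T x : (c *: T) x = c *: T x. Proof. by []. Qed.

Lemma bop0E x : (0 : 'L(X, Y)) x = 0. Proof. by []. Qed.

Lemma bop_sumE (I : Type) (r : seq I) (P : pred I) (F : I -> 'L(X, Y)) x :
  (\sum_(i <- r | P i) F i) x = \sum_(i <- r | P i) F i x.
Proof. by apply: (big_morph (fun T : 'L(X, Y) => T x)). Qed.

End BoundedOperatorAlgebra.

Section OperatorMatrixAlgebra.
Variables (K : numFieldType) (X Y : normedModType K).

Lemma opmx_appDl n m (T T' : 'M['L(X, Y)]_(n, m)) u :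
  opmx_app (T + T') u = opmx_app T u + opmx_app T' u.
Proof.
by apply/colP => i; rewrite !mxE -big_split; apply: eq_bigr => j _; rewrite mxE.
Qed.

Lemma opmx_appNl n m (T : 'M['L(X, Y)]_(n, m)) u :
  opmx_app (- T) u = - opmx_app T u.
Proof.
by apply/colP => i; rewrite !mxE -sumrN; apply: eq_bigr => j _; rewrite mxE.
Qed.

Lemma opmx_appBl n m (T T' : 'M['L(X, Y)]_(n, m)) u :
  opmx_app (T - T') u = opmx_app T u - opmx_app T' u.
Proof. by rewrite opmx_appDl opmx_appNl. Qed.

Lemma opmx_app_scale n m (c : K) (T : 'M['L(X, Y)]_(n, m)) u :
  opmx_app T (cscalemx c u) = cscalemx c (opmx_app T u).
Proof.
apply/colP => i; rewrite !mxE scaler_sumr; apply: eq_bigr => j _.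
by rewrite mxE bopZ.
Qed.

Lemma opmx_app_delta n m (T : 'M['L(X, Y)]_(n, m)) i j x :
  opmx_app T (\col_k if k == j then x else 0) i 0 = T i j x.
Proof.
rewrite mxE (bigD1 j) //= mxE eqxx big1 ?addr0 // => k kj.
by rewrite mxE (negPf kj) bop0.
Qed.

Lemma opmx_ext n m (T T' : 'M['L(X, Y)]_(n, m)) :
  (forall u, opmx_app T u = opmx_app T' u) -> T = T'.
Proof.
move=> TT'; apply/matrixP => i j; apply: bop_ext => x.
by rewrite -!opmx_app_delta TT'.
Qed.

Lemma opmx_app_block n1 n2 m1 m2 (T1 : 'M['L(X, Y)]_(n1, m1))
    (T2 : 'M['L(X, Y)]_(n2, m2)) u1 u2 :
  opmx_app (block_mx T1 0 0 T2) (col_mx u1 u2) =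
  col_mx (opmx_app T1 u1) (opmx_app T2 u2).
Proof.
apply/colP => i; rewrite mxE big_split_ord /=.
case: (split_ordP i) => {}i ->; rewrite ?col_mxEu ?col_mxEd mxE.
  rewrite [X in _ + X]big1 ?addr0 => [|j _]; last by rewrite block_mxEur mxE.
  by apply: eq_bigr => j _; rewrite block_mxEul col_mxEu.
rewrite [X in X + _]big1 ?add0r => [|j _]; last by rewrite block_mxEdl mxE.
by apply: eq_bigr => j _; rewrite block_mxEdr col_mxEd.
Qed.

End OperatorMatrixAlgebra.

Section OperatorMatrixProduct.
Variables (K : numFieldType) (X Y Z : normedModType K).

Lemma opmx_app_mul n p m (S : 'M['L(Y, Z)]_(n, p)) (T : 'M['L(X, Y)]_(p, m)) u :
  opmx_app (opmx_mul S T) u = opmx_app S (opmx_app T u).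
Proof.
apply/colP => i; rewrite !mxE.
under eq_bigr do rewrite mxE bop_sumE.
rewrite exchange_big; apply: eq_bigr => k _; rewrite mxE bop_sum.
by apply: eq_bigr.
Qed.

Lemma opmx_mul_block n1 n2 p1 p2 m1 m2
    (S11 : 'M['L(Y, Z)]_(n1, p1)) S12 S21 (S22 : 'M['L(Y, Z)]_(n2, p2))
    (T11 : 'M['L(X, Y)]_(p1, m1)) T12 T21 (T22 : 'M['L(X, Y)]_(p2, m2)) :
  opmx_mul (block_mx S11 S12 S21 S22) (block_mx T11 T12 T21 T22) =
  block_mx
    (opmx_mul S11 T11 + opmx_mul S12 T21) (opmx_mul S11 T12 + opmx_mul S12 T22)
    (opmx_mul S21 T11 + opmx_mul S22 T21) (opmx_mul S21 T12 + opmx_mul S22 T22).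
Proof.
apply/matrixP => i j; rewrite mxE big_split_ord /=.
case: (split_ordP i) => {}i ->; case: (split_ordP j) => {}j ->; rewrite
  ?block_mxEul ?block_mxEur ?block_mxEdl ?block_mxEdr !mxE;
  congr (_ + _); apply: eq_bigr => k _;
  by rewrite ?block_mxEul ?block_mxEur ?block_mxEdl ?block_mxEdr.
Qed.

Lemma opmx_mulDl n p m (S S' : 'M['L(Y, Z)]_(n, p)) (T : 'M['L(X, Y)]_(p, m)) :
  opmx_mul (S + S') T = opmx_mul S T + opmx_mul S' T.
Proof. by apply: opmx_ext => u; rewrite opmx_appDl !opmx_app_mul opmx_appDl. Qed.

Lemma opmx_mul0l n p m (T : 'M['L(X, Y)]_(p, m)) :
  opmx_mul (0 : 'M['L(Y, Z)]_(n, p)) T = 0.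
Proof. by apply: (@addIr _ (opmx_mul 0 T)); rewrite -opmx_mulDl !add0r. Qed.

Lemma opmx_mulDr n p m (S : 'M['L(Y, Z)]_(n, p)) (T T' : 'M['L(X, Y)]_(p, m)) :
  opmx_mul S (T + T') = opmx_mul S T + opmx_mul S T'.
Proof.
apply/matrixP => i j; rewrite !mxE -big_split; apply: eq_bigr => k _.
by rewrite mxE; apply: bop_ext => x; apply: bopD.
Qed.

Lemma opmx_mul0r n p m (S : 'M['L(Y, Z)]_(n, p)) :
  opmx_mul S (0 : 'M['L(X, Y)]_(p, m)) = 0.
Proof. by apply: (@addIr _ (opmx_mul S 0)); rewrite -opmx_mulDr !add0r. Qed.

Lemma opmx_mul_lscale n q p m (alpha : 'M[K]_(q, n)) (S : 'M['L(Y, Z)]_(n, p))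
    (T : 'M['L(X, Y)]_(p, m)) :
  opmx_mul (lscalemx alpha S) T = lscalemx alpha (opmx_mul S T).
Proof.
apply/matrixP => i j; rewrite !mxE; apply: bop_ext => x; rewrite !bop_sumE.
under eq_bigr do rewrite mxE /= bop_sumE.
rewrite exchange_big; apply: eq_bigr => k _.
by rewrite bopZE mxE bop_sumE scaler_sumr.
Qed.

Lemma opmx_mul_rscale n q p m (S : 'M['L(Y, Z)]_(n, p)) 
    (T : 'M['L(X, Y)]_(p, m)) (beta : 'M[K]_(m, q)) :
  opmx_mul S (rscalemx T beta) = rscalemx (opmx_mul S T) beta.
Proof.
apply/matrixP => i j; rewrite !mxE; apply: bop_ext => x; rewrite !bop_sumE.
under eq_bigr do rewrite mxE /= bop_sumE bop_sum.
rewrite exchange_big; apply: eq_bigr => k _.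
rewrite bopZE mxE bop_sumE scaler_sumr; apply: eq_bigr => l _.
by rewrite bopZE bopZ.
Qed.

Lemma opmx_mul_scaleA n q p m (S : 'M['L(Y, Z)]_(n, q)) (alpha : 'M[K]_(q, p))
    (T : 'M['L(X, Y)]_(p, m)) :
  opmx_mul (rscalemx S alpha) T = opmx_mul S (lscalemx alpha T).
Proof.
apply/matrixP => i j; rewrite !mxE; apply: bop_ext => x; rewrite !bop_sumE.
under eq_bigr do rewrite mxE /= bop_sumE.
rewrite exchange_big; apply: eq_bigr => k _.
rewrite mxE /= bop_sumE bop_sum; apply: eq_bigr => l _.
by rewrite !bopZE bopZ.
Qed.

Lemma opmx_mul_cscale n p m (c : K) (S : 'M['L(Y, Z)]_(n, p))
    (T : 'M['L(X, Y)]_(p, m)) :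
  opmx_mul S (cscalemx c T) = cscalemx c (opmx_mul S T).
Proof.
apply/matrixP => i j; rewrite !mxE scaler_sumr; apply: eq_bigr => k _.
by rewrite mxE; apply: bop_ext => x; apply: bopZ.
Qed.

Lemma opmx_mul_cscalel n p m (c : K) (S : 'M['L(Y, Z)]_(n, p))
    (T : 'M['L(X, Y)]_(p, m)) :
  opmx_mul (cscalemx c S) T = cscalemx c (opmx_mul S T).
Proof.
apply/matrixP => i j; rewrite !mxE scaler_sumr; apply: eq_bigr => k _.
by rewrite mxE; apply: bop_ext.
Qed.

End OperatorMatrixProduct.

(** * Scalar matrices acting on both sides; nc functions respect direct sums *)

Section ScalarMatrixActions.
Variables (K : comPzRingType) (V : lmodType K).

Lemma lscalemxD m n p (alpha : 'M[K]_(m, n)) (Z Z' : 'M[V]_(n, p)) :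
  lscalemx alpha (Z + Z') = lscalemx alpha Z + lscalemx alpha Z'.
Proof.
apply/matrixP => i j; rewrite !mxE -big_split; apply: eq_bigr => k _.
by rewrite mxE scalerDr.
Qed.

Lemma lscalemxN m n p (alpha : 'M[K]_(m, n)) (Z : 'M[V]_(n, p)) :
  lscalemx alpha (- Z) = - lscalemx alpha Z.
Proof.
apply/matrixP => i j; rewrite !mxE -sumrN; apply: eq_bigr => k _.
by rewrite mxE scalerN.
Qed.

Lemma rscalemxD m n p (Z Z' : 'M[V]_(m, n)) (beta : 'M[K]_(n, p)) :
  rscalemx (Z + Z') beta = rscalemx Z beta + rscalemx Z' beta.
Proof.
apply/matrixP => i j; rewrite !mxE -big_split; apply: eq_bigr => k _.
by rewrite mxE scalerDr.
Qed.

Lemma rscalemxN m n p (Z : 'M[V]_(m, n)) (beta : 'M[K]_(n, p)) :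
  rscalemx (- Z) beta = - rscalemx Z beta.
Proof.
apply/matrixP => i j; rewrite !mxE -sumrN; apply: eq_bigr => k _.
by rewrite mxE scalerN.
Qed.

Lemma lrscalemxA m n p q (alpha : 'M[K]_(m, n)) (Z : 'M[V]_(n, p))
    (beta : 'M[K]_(p, q)) :
  lscalemx alpha (rscalemx Z beta) = rscalemx (lscalemx alpha Z) beta.
Proof.
apply/matrixP => i j; rewrite !mxE.
under eq_bigr do rewrite mxE scaler_sumr.
rewrite exchange_big; apply: eq_bigr => k _; rewrite mxE scaler_sumr.
by apply: eq_bigr => l _; rewrite !scalerA mulrC.
Qed.

Lemma lscalemx_col m1 m2 n p (a1 : 'M[K]_(m1, n)) (a2 : 'M[K]_(m2, n))
    (Z : 'M[V]_(n, p)) :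
  lscalemx (col_mx a1 a2) Z = col_mx (lscalemx a1 Z) (lscalemx a2 Z).
Proof.
apply/matrixP => i j; rewrite mxE; case: (split_ordP i) => {}i ->;
  rewrite ?col_mxEu ?col_mxEd mxE; apply: eq_bigr => k _;
  by rewrite ?col_mxEu ?col_mxEd.
Qed.

Lemma rscalemx_row_col m n1 n2 p (Z1 : 'M[V]_(m, n1)) (Z2 : 'M[V]_(m, n2))
    (b1 : 'M[K]_(n1, p)) (b2 : 'M[K]_(n2, p)) :
  rscalemx (row_mx Z1 Z2) (col_mx b1 b2) = rscalemx Z1 b1 + rscalemx Z2 b2.
Proof.
apply/matrixP => i j; rewrite !mxE big_split_ord /=; congr (_ + _);
  apply: eq_bigr => k _;
  by rewrite ?row_mxEl ?row_mxEr ?col_mxEu ?col_mxEd.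
Qed.

Lemma rscalemx_col m1 m2 n p (Z1 : 'M[V]_(m1, n)) (Z2 : 'M[V]_(m2, n))
    (b : 'M[K]_(n, p)) :
  rscalemx (col_mx Z1 Z2) b = col_mx (rscalemx Z1 b) (rscalemx Z2 b).
Proof.
apply/matrixP => i j; rewrite mxE; case: (split_ordP i) => {}i ->;
  rewrite ?col_mxEu ?col_mxEd mxE; apply: eq_bigr => k _;
  by rewrite ?col_mxEu ?col_mxEd.
Qed.

Lemma lscale1mx n p (Z : 'M[V]_(n, p)) : lscalemx 1%:M Z = Z.
Proof.
apply/matrixP => i j; rewrite mxE (bigD1 i) //= mxE eqxx scale1r big1 ?addr0 //.
by move=> k ki; rewrite mxE eq_sym (negPf ki) scale0r.
Qed.

Lemma rscale1mx n p (Z : 'M[V]_(n, p)) : rscalemx Z 1%:M = Z.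
Proof.
apply/matrixP => i j; rewrite mxE (bigD1 j) //= mxE eqxx scale1r big1 ?addr0 //.
by move=> k kj; rewrite mxE (negPf kj) scale0r.
Qed.

Lemma lscale0mx m n p (Z : 'M[V]_(n, p)) : lscalemx (0 : 'M[K]_(m, n)) Z = 0.
Proof. by apply/matrixP => i j; rewrite !mxE big1 // => k _; rewrite mxE scale0r. Qed.

Lemma rscale0mx m n p (Z : 'M[V]_(n, p)) : rscalemx Z (0 : 'M[K]_(p, m)) = 0.
Proof. by apply/matrixP => i j; rewrite !mxE big1 // => k _; rewrite mxE scale0r. Qed.

End ScalarMatrixActions.

(* The direct sum is determined by its intertwinings with the two coordinate
   embeddings. *)
Lemma nc_function_global (K : comPzRingType) (V : lmodType K)
    (Omega : ncsubset V) (B : lmodType K) (f : ncfun V B) :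
  nc_set 0 Omega -> nc_function Omega f -> global_function 0 Omega f.
Proof.
move=> [_ ncO] ncf n m Z W OZ OW; have ODS := ncO _ _ _ _ OZ OW.
have /(_ (col_mx 1%:M 0))/= := ncf _ _ _ _ _ OZ ODS.
have /(_ (col_mx 0 1%:M))/= := ncf _ _ _ _ _ OW ODS.
(* [F] is cut into four blocks; each embedding determines one block column. *)
set F := f (n + m)%N _; rewrite -[F]matrix.submxK /dsum !block_mxEh.
have c0 p q : const_mx 0 = 0 :> 'M[V]_(p, q) by apply/matrixP => i j; rewrite !mxE.
rewrite !c0 !rscalemx_row_col !lscalemx_col !rscalemx_col.
rewrite !lscale1mx !rscale1mx !lscale0mx !rscale0mx !add_col_mx !addr0 !add0r.
by move=> /(_ erefl) <- /(_ erefl) <-.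
Qed.

(** * Inner product of columns and adjoints of operator matrices *)

Section Adjoints.
Variables (R : realType) (X Y : hilbertType R).

Lemma cvdotDl n (y y' z : 'cV[X]_n) : cvdot (y + y') z = cvdot y z + cvdot y' z.
Proof.
by rewrite /cvdot -big_split; apply: eq_bigr => i _; rewrite mxE dotDl.
Qed.

Lemma cvdotNl n (y z : 'cV[X]_n) : cvdot (- y) z = - cvdot y z.
Proof. by rewrite /cvdot -sumrN; apply: eq_bigr => i _; rewrite mxE dotNl. Qed.

Lemma cvdotBl n (y y' z : 'cV[X]_n) : cvdot (y - y') z = cvdot y z - cvdot y' z.
Proof. by rewrite cvdotDl cvdotNl. Qed.

Lemma cvdotZr n c (y z : 'cV[X]_n) : cvdot y (cscalemx c z) = c^* * cvdot y z.
Proof. by rewrite /cvdot mulr_sumr; apply: eq_bigr => i _; rewrite mxE dotZr. Qed.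

Lemma cvdot_col n m (y1 z1 : 'cV[X]_n) (y2 z2 : 'cV[X]_m) :
  cvdot (col_mx y1 y2) (col_mx z1 z2) = cvdot y1 z1 + cvdot y2 z2.
Proof.
rewrite /cvdot big_split_ord; congr (_ + _); apply: eq_bigr => i _;
  by rewrite ?col_mxEu ?col_mxEd.
Qed.

Lemma cvdot_ext n (y y' : 'cV[X]_n) :
  (forall z, cvdot y z = cvdot y' z) -> y = y'.
Proof.
move=> yy'; apply/colP => i; apply: dot_ext => z.
have delta (u : 'cV[X]_n) : cvdot u (\col_k if k == i then z else 0) = dot (u i 0) z.
  rewrite /cvdot (bigD1 i) //= mxE eqxx big1 ?addr0 // => k ki.
  by rewrite mxE (negPf ki) dot0r.
by rewrite -!delta yy'.
Qed.

Lemma opmx_adjP n m (T : 'M['L(X, Y)]_(n, m)) u y :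
  cvdot (opmx_app T u) y = cvdot u (opmx_app (opmx_adj T) y).
Proof.
rewrite /cvdot.
under eq_bigr do rewrite mxE dot_suml.
rewrite exchange_big; apply: eq_bigr => i _; rewrite mxE dot_sumr.
by apply: eq_bigr => j _; rewrite mxE adjointP.
Qed.

Lemma opmx_adj_block n1 n2 m1 m2 (T1 : 'M['L(X, Y)]_(n1, m1))
    (T2 : 'M['L(X, Y)]_(n2, m2)) :
  opmx_adj (block_mx T1 0 0 T2) = block_mx (opmx_adj T1) 0 0 (opmx_adj T2).
Proof.
have adj0 : adjoint (0 : 'L(X, Y)) = 0.
  by apply: adjoint_unique => x y; rewrite bop0E dot0l bop0E dot0r.
apply/matrixP => i j; rewrite mxE.
by case: (split_ordP i) => {}i ->; case: (split_ordP j) => {}j ->; rewrite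
  ?block_mxEul ?block_mxEur ?block_mxEdl ?block_mxEdr !mxE.
Qed.

Lemma opmx_adj_lscale n m p (alpha : 'M[R[i]]_(p, n)) (T : 'M['L(X, Y)]_(n, m)) :
  opmx_adj (lscalemx alpha T) = rscalemx (opmx_adj T) (adjmx alpha).
Proof.
apply/matrixP => i j; rewrite !mxE; apply: adjoint_unique => x y.
rewrite !bop_sumE dot_suml dot_sumr; apply: eq_bigr => k _.
by rewrite !mxE bopZE dotZl bopZE dotZr conjCK adjointP.
Qed.

Lemma opmx_adj_rscale n m p (T : 'M['L(X, Y)]_(n, m)) (beta : 'M[R[i]]_(m, p)) :
  opmx_adj (rscalemx T beta) = lscalemx (adjmx beta) (opmx_adj T).
Proof.
apply/matrixP => i j; rewrite !mxE; apply: adjoint_unique => x y.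
rewrite !bop_sumE dot_suml dot_sumr; apply: eq_bigr => k _.
by rewrite !mxE bopZE dotZl bopZE dotZr conjCK adjointP.
Qed.

End Adjoints.

(** * The kernel property of [kernel_S], apart from positivity *)

Section KernelS.
Variables (R : realType) (A : cstarType R) (U Y : hilbertType R) (T : Type).
Variables (Omega : ncsubset T) (K' : nckernel A U T) (K : nckernel A Y T).
Variable (S : ncfun T 'L(U, Y)).

Lemma kernel_S_graded :
  graded_kernel Omega K' -> graded_kernel Omega K ->
  graded_kernel Omega (kernel_S K' K S).
Proof.
move=> gK' gK n m Z W OZ OW c P Q; rewrite /kernel_S gK // gK' //.
rewrite opmx_mulDr opmx_mulDl opmx_mul_cscale opmx_mul_cscalel.
rewrite opprD addrACA; congr (_ + _).
by apply/matrixP => i j; rewrite !mxE scalerBr.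
Qed.

(** On direct sums [S] and its adjoint are block diagonal, so multiplying by them on the two sides
    acts on each block of [K'] separately. *)
Lemma kernel_S_global (o : T) :
  global_kernel o Omega K' -> global_kernel o Omega K ->
  global_function o Omega S -> global_kernel o Omega (kernel_S K' K S).
Proof.
move=> [gK' dK'] [gK dK] dS; split; first exact: kernel_S_graded.
move=> n nt m mt Z Zt W Wt P11 P12 P21 P22 OZ OZt OW OWt.
rewrite /kernel_S dK // dK' // !dS // opmx_adj_block !opmx_mul_block.
by rewrite !opmx_mul0l !opmx_mul0r !addr0 !add0r opp_block_mx add_block_mx.
Qed.

End KernelS.

(** [alpha] passes through [S(Z)] by the intertwining property of [S]; the adjoint of the same
    property for [beta] moves [beta^*] through [S(W)^*]. Both then meet [K'], which absorbs them. *)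
Lemma kernel_S_nc (R : realType) (A : cstarType R) (U Y : hilbertType R)
    (V : lmodType R[i]) (Omega : ncsubset V) (K' : nckernel A U V)
    (K : nckernel A Y V) (S : ncfun V 'L(U, Y)) :
  nc_kernel Omega K' -> nc_kernel Omega K -> nc_function Omega S ->
  nc_kernel Omega (kernel_S K' K S).
Proof.
move=> [gK' iK'] [gK iK] iS; split; first exact: kernel_S_graded.
move=> n nt m mt Z Zt W Wt alpha beta P OZ OZt OW OWt aZ bW.
rewrite /kernel_S -(iK _ _ _ _ _ _ _ _ _ _ _ OZ OZt OW OWt aZ bW).
rewrite -(iK' _ _ _ _ _ _ _ _ _ _ _ OZ OZt OW OWt aZ bW).
rewrite lscalemxD rscalemxD lscalemxN rscalemxN; congr (_ - _).
rewrite -!opmx_mul_lscale -opmx_mul_rscale -opmx_adj_lscale.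
rewrite (iS _ _ _ _ _ OZ OZt aZ) (iS _ _ _ _ _ OW OWt bW).
rewrite opmx_adj_rscale -opmx_mul_scaleA -opmx_mul_rscale.
by rewrite opmx_mul_scaleA lrscalemxA.
Qed.

(** * Positive matrices over the C*-algebra and their rows *)

Section Starmx.
Variables (R : realType) (A : cstarType R).

Lemma starmxK n m (P : 'M[A]_(n, m)) : starmx (starmx P) = P.
Proof. by apply/matrixP => i j; rewrite !mxE starK. Qed.

Lemma starmx_row n m1 m2 (P : 'M[A]_(n, m1)) (Q : 'M[A]_(n, m2)) :
  starmx (row_mx P Q) = col_mx (starmx P) (starmx Q).
Proof.
apply/matrixP => i j; rewrite mxE.
by case: (split_ordP i) => {}i ->;
  rewrite ?row_mxEl ?row_mxEr ?col_mxEu ?col_mxEd mxE.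
Qed.

Lemma starmx_mul_sum n (Q : 'M[A]_n) :
  starmx Q *m Q = \sum_i starmx (row i Q) *m row i Q.
Proof.
apply/matrixP => i j; rewrite mxE summxE; apply: eq_bigr => k _.
by rewrite !mxE big_ord1 !mxE.
Qed.

(* A row is a square matrix after padding with zero rows. *)
Lemma cstar_psd_row n (v : 'rV[A]_n) : cstar_psd (starmx v *m v).
Proof.
case: n v => [|n] v; first by exists 0; apply/matrixP => -[].
exists (\matrix_(i, j) if i == 0 then v 0 j else 0).
apply/matrixP => i j; rewrite !mxE big_ord1 !mxE (bigD1 0) //= !mxE eqxx.
by rewrite big1 ?addr0 // => k k0; rewrite !mxE (negPf k0) mulr0.
Qed.

End Starmx.

(** * Linear combinations of kernel functions *)

Section Rkhs.
Variables (R : realType) (A : cstarType R) (Y : hilbertType R) (T : Type) (o : T).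
Variables (Omega : ncsubset T) (class : ncfun T 'L(A, Y) -> Prop).
Variables (K : nckernel A Y T) (H : hilbertType R) (ev : H -> ncfun T 'L(A, Y)).
Hypothesis ncO : nc_set o Omega.
Hypothesis class_global : forall f, class f -> global_function o Omega f.
Hypothesis HK : is_rkhs Omega class K ev.

(* Hence the kernel functions form a linear subspace of the Hilbert space. *)
Lemma kernel_function_dsum c m1 m2 (W1 : 'M[T]_m1) (W2 : 'M[T]_m2)
    v1 v2 y1 y2 (k1 k2 : H) :
  Omega W1 -> Omega W2 ->
  is_kernel_function Omega K W1 v1 y1 (ev k1) ->
  is_kernel_function Omega K W2 v2 y2 (ev k2) ->
  is_kernel_function Omega K (dsum o W1 W2) (row_mx v1 v2)
    (col_mx (cscalemx c y1) y2) (ev (c *: k1 + k2)).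
Proof.
move=> O1 O2 K1 K2; have OW := ncO.2 _ _ _ _ O1 O2.
have [k Kk] := rkhs_kernel HK (row_mx v1 v2) (col_mx (cscalemx c y1) y2) OW.
(* The kernel function [k] at the direct sum exists; pairing with any [f], block diagonal there,
   splits into the pairings with [k1] and [k2]. The scalar comes out conjugated on both sides. *)
suff -> : c *: k1 + k2 = k by [].
apply: dot_ext => f; rewrite dot_conj [RHS]dot_conj; congr (_ ^*).
rewrite -(rkhs_reproducing HK OW Kk) starmx_row.
rewrite (class_global (rkhs_class HK f)) // opmx_app_block cvdot_col cvdotZr.
rewrite (rkhs_reproducing HK O1 K1) (rkhs_reproducing HK O2 K2).
by rewrite dotDr dotZr.
Qed.

End Rkhs.

(** * Contractive multipliers and complete positivity *)

Section Multiplier.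
Variables (R : realType) (A : cstarType R) (U Y : hilbertType R) (T : Type) (o : T).
Variables (Omega : ncsubset T) (K' : nckernel A U T) (K : nckernel A Y T).
Variable S : ncfun T 'L(U, Y).
Variables (class' : ncfun T 'L(A, U) -> Prop) (class : ncfun T 'L(A, Y) -> Prop).
Variables (H' : hilbertType R) (ev' : H' -> ncfun T 'L(A, U)).
Variables (H : hilbertType R) (ev : H -> ncfun T 'L(A, Y)).
Hypothesis HK' : is_rkhs Omega class' K' ev'.
Hypothesis HK : is_rkhs Omega class K ev.

(** Evaluating [k] at [W] on [v^*] produces [K(W,W)(v^* v) y], and the reproducing property turns
    its pairing with [y] into [|k|^2]; for [k'] the outer factor [S(W)] first crosses over as an
    adjoint. *)
Lemma kernel_S_diag m (W : 'M[T]_m) v y (k : H) (k' : H') : Omega W ->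
  is_kernel_function Omega K W v y (ev k) ->
  is_kernel_function Omega K' W v (opmx_app (opmx_adj (S W)) y) (ev' k') ->
  cvdot (opmx_app (kernel_S K' K S W W (starmx v *m v)) y) y =
  (rnorm k ^+ 2 - rnorm k' ^+ 2)%:C.
Proof.
move=> OW Kk Kk'; rewrite rmorphB !rmorphXn /= -!rnormE -!dot_norm.
rewrite /kernel_S opmx_appBl !opmx_app_mul cvdotBl -Kk // -Kk' //.
by rewrite (rkhs_reproducing HK OW Kk) opmx_adjP (rkhs_reproducing HK' OW Kk').
Qed.

Lemma multiplier_cp :
  graded_kernel Omega (kernel_S K' K S) ->
  contractive_multiplier Omega S ev' ev -> cp Omega (kernel_S K' K S).
Proof.
move=> gS [M [evM M1]] n Z OZ _ [Q ->] y; rewrite starmx_mul_sum.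
have KSD P P' : kernel_S K' K S Z Z (P + P') =
    kernel_S K' K S Z Z P + kernel_S K' K S Z Z P'.
  have c1 (B : lmodType R[i]) p q (X : 'M[B]_(p, q)) : cscalemx 1 X = X.
    by apply/matrixP => i j; rewrite mxE scale1r.
  by rewrite -[in LHS](c1 _ _ _ P) gS // c1.
have KS0 : kernel_S K' K S Z Z 0 = 0.
  by apply: (@addIr _ (kernel_S K' K S Z Z 0)); rewrite -KSD !add0r.
(* [phi] is additive in [P], so positivity is checked on one row of [Q] at a time. *)
pose phi P := cvdot (opmx_app (kernel_S K' K S Z Z P) y) y.
rewrite -/(phi _) (big_morph phi (id1 := 0) (op1 := +%R)); first last.
- rewrite /phi KS0; apply: (@addIr _ (phi 0)).
  by rewrite /phi KS0 -cvdotDl -opmx_appDl !add0r.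
- by move=> P P'; rewrite /phi KSD opmx_appDl cvdotDl.
apply: sumr_ge0 => i _; set v := row i Q.
have [k Kk] := rkhs_kernel HK v y OZ.
have [k' Kk'] := rkhs_kernel HK' v (opmx_app (opmx_adj (S Z)) y) OZ.
rewrite /phi (kernel_S_diag OZ Kk Kk') ler0c subr_ge0.
rewrite ler_sqr ?nnegrE ?rnorm_ge0 //.
have [->|k0] := eqVneq (rnorm k') 0; first exact: rnorm_ge0.
have kp : 0 < rnorm k' by rewrite lt0r k0 rnorm_ge0.
rewrite -(ler_pM2l kp) -expr2 -rdot_norm /rdot -(rkhs_reproducing HK' OZ Kk').
rewrite -opmx_adjP -opmx_app_mul -evM // (rkhs_reproducing HK OZ Kk).
apply: le_trans (rdot_le _ _) _; rewrite ler_wpM2r ?rnorm_ge0 //.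
by rewrite -lecR -!rnormE.
Qed.

Hypothesis ncO : nc_set o Omega.
Hypothesis class'_global : forall f, class' f -> global_function o Omega f.
Hypothesis class_global : forall f, class f -> global_function o Omega f.
Hypothesis S_global : global_function o Omega S.

(* The adjoint of the multiplier sends [K_{W,v,y}] to [K'_{W,v,S(W)^* y}]; this
   is a contraction on the span of the kernel functions, and the Riesz theorem
   turns the functional [k |-> <k', f>] into the product of [S] and [f]. *)
Lemma cp_multiplier_at (f : H') : cp Omega (kernel_S K' K S) ->
  exists2 g : H, rnorm g <= rnorm f & forall n (W : 'M[T]_n), Omega W ->
    ev g W = opmx_mul (S W) (ev' f W).
Proof.
move=> cpS.
(* For empty [Omega] the set [D] below would be empty, hence not linear; there 0 works vacuously. *)
have [[m0 [W0 O0]]|O0] := pselect (exists m (W : 'M[T]_m), Omega W); last first.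
  exists 0; last by move=> n W OW; case: O0; exists n, W.
  by rewrite -lecR -!rnormE normr0.
(* A relation rather than a function, since one [k] may come from several [W], [v], [y];
   single-valuedness follows from the Riesz theorem. *)
pose D : set (H * R[i]) := [set p | exists m (W : 'M[T]_m) v y k',
  [/\ Omega W, is_kernel_function Omega K W v y (ev p.1),
   is_kernel_function Omega K' W v (opmx_app (opmx_adj (S W)) y) (ev' k') &
   p.2 = dot k' f]].
have Dlin c x l y m : D (x, l) -> D (y, m) -> D (c *: x + y, c * l + m).
  move=> [m1 [W1 [v1 [y1 [k1 [/= O1 Kx Kk1 ->]]]]]].
  move=> [m2 [W2 [v2 [y2 [k2 [/= O2 Ky Kk2 ->]]]]]].
  exists _, (dsum o W1 W2), (row_mx v1 v2), (col_mx (cscalemx c y1) y2).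
  exists (c *: k1 + k2); split;
    [exact: ncO.2|exact: (kernel_function_dsum ncO class_global HK)| |].
    rewrite S_global // opmx_adj_block opmx_app_block opmx_app_scale.
    exact: (kernel_function_dsum ncO class'_global HK').
  by rewrite dotDl dotZl.
have [|||g gf gD] := @riesz_relation _ _ D (rnorm f) _ Dlin.
(* The zero pair is [-p + p] for any [p] in [D]. *)
- have [k Kk] := rkhs_kernel HK 0 0 O0.
  have [k' Kk'] := rkhs_kernel HK' 0 (opmx_app (opmx_adj (S W0)) 0) O0.
  have Dk : D (k, dot k' f) by exists m0, W0, 0, 0, k'.
  by have := Dlin (-1) _ _ _ _ Dk Dk; rewrite scaleN1r mulN1r !addNr.
- exact: rnorm_ge0.
- move=> x _ [m [W [v [y [k' [/= OW Kx Kk' ->]]]]]].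
  (* It remains to see [|k'| <= |k|], which is positivity of [K_S] at [v^* v]. *)
  apply: le_trans (rdot_le _ _) _; rewrite mulrC ler_wpM2l ?rnorm_ge0 //.
  rewrite -ler_sqr ?nnegrE ?rnorm_ge0 // -subr_ge0 -ler0c.
  by rewrite -(kernel_S_diag OW Kx Kk'); apply: cpS => //; apply: cstar_psd_row.
(* Tested against [u = v^*] and [y], the claim becomes [<g, k> = <f, k'>], the conjugate of what
   Riesz provides. *)
exists g => // n W OW; apply: opmx_ext => u; apply: cvdot_ext => y.
rewrite -[u]starmxK opmx_app_mul opmx_adjP; set v := starmx u.
have [k Kk] := rkhs_kernel HK v y OW.
have [k' Kk'] := rkhs_kernel HK' v (opmx_app (opmx_adj (S W)) y) OW.
rewrite (rkhs_reproducing HK OW Kk) (rkhs_reproducing HK' OW Kk').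
rewrite dot_conj [RHS]dot_conj; congr (_ ^*).
by apply: gD; exists n, W, v, y, k'.
Qed.

(** The images are chosen one [f] at a time; linearity holds because an element of [H] is determined
    by its values on [Omega], and these depend linearly on [f]. *)
Lemma cp_multiplier :
  cp Omega (kernel_S K' K S) -> contractive_multiplier Omega S ev' ev.
Proof.
move=> cpS; have /choice[F FP] f : exists g : H, rnorm g <= rnorm f /\
    forall n (W : 'M[T]_n), Omega W -> ev g W = opmx_mul (S W) (ev' f W).
  by have [g] := cp_multiplier_at f cpS; exists g.
have F1 f : `|F f| <= `|f| :> R[i] by rewrite !rnormE lecR; have [] := FP f.
have Fb : F \in @bounded_linear_pred _ H' H.
  apply/asboolP; split=> [c f g|]; last by exists 1 => f; rewrite mul1r.
  apply: (rkhs_inj HK) => n Z OZ; rewrite (rkhs_linear HK) //.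
  have evF h : ev (F h) Z = opmx_mul (S Z) (ev' h Z) by apply: (FP h).2.
  by rewrite !evF (rkhs_linear HK') // opmx_mulDr opmx_mul_cscale.
by exists (Bop Fb); split=> //= f n W OW; apply: (FP f).2.
Qed.

End Multiplier.
Theorem theorem4p1 (R : realType) (A : cstarType R) (U Y : hilbertType R) :
  (forall (T : Type) (o : T) (Omega : ncsubset T)
     (K' : nckernel A U T) (K : nckernel A Y T) (S : ncfun T 'L(U, Y)),
     nc_set o Omega ->
     cp_global_kernel o Omega K' ->
     cp_global_kernel o Omega K ->
     global_function o Omega S ->
     forall (H' : hilbertType R) (ev' : H' -> ncfun T 'L(A, U))
       (H : hilbertType R) (ev : H -> ncfun T 'L(A, Y)),
     is_rkhs Omega (global_function o Omega (B := 'L(A, U))) K' ev' ->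
     is_rkhs Omega (global_function o Omega (B := 'L(A, Y))) K ev ->
     contractive_multiplier Omega S ev' ev <->
     cp_global_kernel o Omega (kernel_S K' K S))
  /\
  (forall (V : lmodType R[i]) (Omega : ncsubset V)
     (K' : nckernel A U V) (K : nckernel A Y V) (S : ncfun V 'L(U, Y)),
     nc_set 0 Omega ->
     cp_nc_kernel Omega K' ->
     cp_nc_kernel Omega K ->
     nc_function Omega S ->
     forall (H' : hilbertType R) (ev' : H' -> ncfun V 'L(A, U))
       (H : hilbertType R) (ev : H -> ncfun V 'L(A, Y)),
     is_rkhs Omega (nc_function Omega (B := 'L(A, U))) K' ev' ->
     is_rkhs Omega (nc_function Omega (B := 'L(A, Y))) K ev ->
     contractive_multiplier Omega S ev' ev <->
     cp_nc_kernel Omega (kernel_S K' K S)).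
Proof.
split=> [T o Omega K' K S ncO [gK' _] [gK _] gS H' ev' H ev HK' HK|
  V Omega K' K S ncO [nK' _] [nK _] nS H' ev' H ev HK' HK].
  (* [kernel_S] is a global kernel in either direction, so only positivity is at stake. *)
  have gKS := kernel_S_global gK' gK gS.
  split=> [MS|[_ cpS]]; last exact: (cp_multiplier HK' HK ncO).
  by split=> //; apply: (multiplier_cp HK' HK) => //; case: gKS.
have nKS := kernel_S_nc nK' nK nS.
split=> [MS|[_ cpS]]; last first.
  (* The direct sum argument applies because nc functions are global functions. *)
  by apply: (cp_multiplier HK' HK ncO) => // [f|f|]; apply: nc_function_global.
by split=> //; apply: (multiplier_cp HK' HK) => //; case: nKS.
Qed.
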